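(* Let $U$ and $A$ be algebras over a field $k$ and let $H = U\otimes A$ be an algebra structure on the tensor product of the underlying vector spaces of $U$ and $A$ which satisfies $$(u\otimes a)(u'\otimes a') = uu'\otimes aa' \quad\text{whenever } a = 1 \text{ or } u' = 1 .$$ Suppose that: a) $U'$ is a subalgebra of $U$ such that $(u\otimes a)\cdot_\chi u' = \chi(a)uu'$ for all $u\in U$, $a\in A$, $\chi\in \mathrm{Alg}(A,k)$ and $u'\in U'$, and such that the restriction map $\mathrm{Alg}(U,k)\to \mathrm{Alg}(U',k)$ is one-one; b) $A'$ is a subalgebra of $A$ such that $a'\cdot_\rho (u\otimes a) = \rho(u)a'a$ for all $a'\in A'$, $\rho\in\mathrm{Alg}(U,k)$, $u\in U$ and $a\in A$, and such that the restriction map $\mathrm{Alg}(A,k)\to\mathrm{Alg}(A',k)$ is one-one. Then the map $\mathrm{Alg}(U,k)\times\mathrm{Alg}(A,k)\to [{}_H\underline{\mathcal M}]$ given by $(\rho,\chi)\mapsto [L(\rho,\chi)]$ is bijective.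
   Context: Algebras are associative and unital; $\otimes=\otimes_k$; $\mathrm{Alg}(X,k)$ is the set of unital algebra homomorphisms $X\to k$. $U$ and $A$ are regarded as subalgebras of $H$ via $u\mapsto u\otimes 1$ and $a\mapsto 1\otimes a$; thus left (right) $H$-modules are left (right) $U$- and $A$-modules. For $\chi\in\mathrm{Alg}(A,k)$, $U_\chi$ is the left $H$-module with underlying space $U$ and action $$(u\otimes a)\cdot_\chi u' = u\,\big((\mathrm{id}_U\otimes\chi)((1\otimes a)(u'\otimes 1))\big)$$ (this is the induced module $H\otimes_A k$, where $A$ acts on $k$ through $\chi$). For $\rho\in\mathrm{Alg}(U,k)$, $A_\rho$ is the right $H$-module with underlying space $A$ and action $$a\cdot_\rho(u\otimes a') = \big((\rho\otimes\mathrm{id}_A)((1\otimes a)(u\otimes 1))\big)\,a' .$$ $I(\rho,\chi)$ is the sum of all left $H$-submodules of $U_\chi$ contained in $\mathrm{Ker}\,\rho$, and $L(\rho,\chi)=U_\chi/I(\rho,\chi)$ is the quotient left $H$-module. ${}_H\underline{\mathcal M}$ is the category whose objects are the left $H$-modules $M$ which are generated (as $H$-modules) by some one-dimensional left $A$-submodule $km$ and which have some codimension one left $U$-submodule $N$ such that $(0)$ is the only left $H$-submodule of $M$ contained in $N$; morphisms are left $H$-module maps. Each $L(\rho,\chi)$ is an object of it. $[\mathcal C]$ denotes the isomorphism classes of objects of a category $\mathcal C$, and $[M]$ the class of $M$. *)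

(* Defs.v *)
From HB Require Import structures.
From mathcomp Require Import all_boot all_order all_algebra.
From mathcomp Require Import boolp.

Set Implicit Arguments.
Unset Strict Implicit.
Unset Printing Implicit Defensive.

Import GRing.Theory.

Local Open Scope ring_scope.
Local Open Scope quotient_scope.

Definition Alg (k : fieldType) (X : algType k) := {lrmorphism X -> k | *%R}.

Section Restriction.
Variables (k : fieldType) (X : algType k) (Y : subalgClosed X).

Record subalgebra := Subalgebra { subalg_val :> X; _ : subalg_val \in Y }.

HB.instance Definition _ := [isSub for subalg_val].
HB.instance Definition _ := [Choice of subalgebra by <:].
HB.instance Definition _ := [SubChoice_isSubAlgebra of subalgebra by <:].

Fact subalg_val_zmod_morphism : zmod_morphism subalg_val.
Proof. exact: (rmorphB val). Qed.
Fact subalg_val_monoid_morphism : monoid_morphism subalg_val.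
Proof. by split; [exact: (rmorph1 val) | exact: (rmorphM val)]. Qed.
Fact subalg_val_scalable : scalable subalg_val.
Proof. exact: (linearZZ val). Qed.
HB.instance Definition _ := GRing.isZmodMorphism.Build subalgebra X
  subalg_val subalg_val_zmod_morphism.
HB.instance Definition _ := GRing.isMonoidMorphism.Build subalgebra X
  subalg_val subalg_val_monoid_morphism.
HB.instance Definition _ := GRing.isScalable.Build k subalgebra X *:%R
  subalg_val subalg_val_scalable.

Definition restr (f : Alg X) : Alg subalgebra :=
  (f : {lrmorphism X -> k | *%R}) \o subalg_val.

End Restriction.

(* [T] is V (x)_k W: the universal property, which determines (T, t) up to a
   unique isomorphism. *)
Definition is_tensor_product (k : fieldType) (V W T : lmodType k)
    (t : {bilinear V -> W -> T}) : Prop :=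
  forall (X : lmodType k) (f : {bilinear V -> W -> X}),
    exists g : {linear T -> X},
      (forall v w, g (t v w) = f v w) /\
      (forall g' : {linear T -> X},
         (forall v w, g' (t v w) = f v w) -> g' =1 g).

(* An algebra H whose underlying vector space is U (x) A, with [tens H u a] the
   pure tensor.  The unit of H is necessarily [tens H 1 1]: see [tens11]. *)
Record tensor_algebra (k : fieldType) (U A : algType k) := TensorAlgebra {
  tensor_sort :> algType k;
  tens : {bilinear U -> A -> tensor_sort};
  tensP : is_tensor_product tens;
  tens_mul : forall u a u' a', a = 1 \/ u' = 1 ->
    tens u a * tens u' a' = tens (u * u') (a * a')
}.

Section Linearization.
Variables (k : fieldType) (U A : algType k) (H : tensor_algebra U A).

(* The unique linear map on U (x) A sending [tens H u a] to [f u a]. *)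
Definition tens_lift (X : lmodType k) (f : {bilinear U -> A -> X}) :
  {linear H -> X} := sval (cid (@tensP _ _ _ H X f)).

Lemma tens_liftE (X : lmodType k) (f : {bilinear U -> A -> X}) u a :
  tens_lift f (tens H u a) = f u a.
Proof. by rewrite /tens_lift; case: cid => g []. Qed.

Lemma tens_ext (X : lmodType k) (g g' : {linear H -> X}) :
  (forall u a, g (tens H u a) = g' (tens H u a)) -> g =1 g'.
Proof.
move=> gg'.
have bil : bilinear_for *:%R *:%R (fun u a => g (tens H u a)).
  split=> [a c u u' | u c a a'] /=.
    by rewrite linearPl linearP.
  by rewrite linearPr linearP.
pose f : {bilinear U -> A -> X} :=
  HB.pack (fun u a => g (tens H u a))
    (bilinear_isBilinear.Build _ _ _ _ _ _ _ bil).
have [h [_ hP]] := @tensP _ _ _ H X f.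
by move=> x; rewrite (hP g _ x) ?(hP g' _ x) // => u a; rewrite -gg'.
Qed.

Lemma tens_mulll u u' a : tens H u 1 * tens H u' a = tens H (u * u') a.
Proof. by rewrite tens_mul ?mul1r //; left. Qed.

Lemma tens_mulrr u a a' : tens H u a * tens H 1 a' = tens H u (a * a').
Proof. by rewrite tens_mul ?mulr1 //; right. Qed.

Lemma tens11 : tens H 1 1 = 1.
Proof.
have idl : forall x : H, tens H 1 1 * x = x.
  move=> x; pose g : {linear H -> H} := tens H 1 1 \*o idfun.
  apply: (tens_ext (g := g) (g' := idfun)) => u a /=.
  by rewrite tens_mulll mul1r.
by rewrite -[LHS]mulr1 idl.
Qed.

(* id_U (x) chi *)
Definition id_tens_fun (chi : Alg A) (u : U) (a : A) : U := chi a *: u.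

Fact id_tens_bilinear chi : bilinear_for *:%R *:%R (id_tens_fun chi).
Proof.
split=> [a c u u' | u c a a']; rewrite /id_tens_fun /=.
  by rewrite scalerDr !scalerA [c * _]mulrC.
by rewrite linearP scalerDl scalerA.
Qed.

HB.instance Definition _ chi :=
  bilinear_isBilinear.Build _ _ _ _ _ _ _ (id_tens_bilinear chi).

Definition id_tens (chi : Alg A) : {linear H -> U} :=
  tens_lift (id_tens_fun chi).

(* rho (x) id_A *)
Definition tens_id_fun (rho : Alg U) (u : U) (a : A) : A := rho u *: a.

Fact tens_id_bilinear rho : bilinear_for *:%R *:%R (tens_id_fun rho).
Proof.
split=> [a c u u' | u c a a']; rewrite /tens_id_fun /=.
  by rewrite linearP scalerDl scalerA.
by rewrite scalerDr !scalerA [c * _]mulrC.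
Qed.

HB.instance Definition _ rho :=
  bilinear_isBilinear.Build _ _ _ _ _ _ _ (tens_id_bilinear rho).

Definition tens_id (rho : Alg U) : {linear H -> A} :=
  tens_lift (tens_id_fun rho).

(* The left action on U_chi, on all of H by linearity; [lactE] gives it on pure
   tensors. *)
Definition lact_fun (chi : Alg A) (u' u : U) (a : A) : U :=
  u * id_tens chi (tens H 1 a * tens H u' 1).

Fact lact_bilinear chi u' : bilinear_for *:%R *:%R (lact_fun chi u').
Proof.
split=> [a c u v | u c a a']; rewrite /lact_fun /=.
  by rewrite mulrDl -scalerAl.
by rewrite linearPr mulrDl -scalerAl linearP mulrDr -scalerAr.
Qed.

HB.instance Definition _ chi u' :=
  bilinear_isBilinear.Build _ _ _ _ _ _ _ (lact_bilinear chi u').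

Definition lact (chi : Alg A) (h : H) (u' : U) : U :=
  tens_lift (lact_fun chi u') h.

Lemma lactE chi u a u' :
  lact chi (tens H u a) u' = u * id_tens chi (tens H 1 a * tens H u' 1).
Proof. exact: tens_liftE. Qed.

(* The right action on A_rho; [ractE] gives it on pure tensors. *)
Definition ract_fun (rho : Alg U) (a : A) (u : U) (a' : A) : A :=
  tens_id rho (tens H 1 a * tens H u 1) * a'.

Fact ract_bilinear rho a : bilinear_for *:%R *:%R (ract_fun rho a).
Proof.
split=> [a' c u v | u c a' a'']; rewrite /ract_fun /=.
  by rewrite linearPl mulrDr -scalerAr linearP mulrDl -scalerAl.
by rewrite mulrDr -scalerAr.
Qed.

HB.instance Definition _ rho a :=
  bilinear_isBilinear.Build _ _ _ _ _ _ _ (ract_bilinear rho a).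

Definition ract (rho : Alg U) (a : A) (h : H) : A :=
  tens_lift (ract_fun rho a) h.

Lemma ractE rho a u a' :
  ract rho a (tens H u a') = tens_id rho (tens H 1 a * tens H u 1) * a'.
Proof. exact: tens_liftE. Qed.

Lemma id_tensE chi u a : id_tens chi (tens H u a) = chi a *: u.
Proof. exact: tens_liftE. Qed.

Lemma tens_idE rho u a : tens_id rho (tens H u a) = rho u *: a.
Proof. exact: tens_liftE. Qed.

Lemma id_tens_mull chi u x : id_tens chi (tens H u 1 * x) = u * id_tens chi x.
Proof.
pose mulH : {linear H -> H} := tens H u 1 \*o idfun.
pose g1 : {linear H -> U} := id_tens chi \o mulH.
pose g2 : {linear H -> U} := u \*o id_tens chi.
apply: (tens_ext (g := g1) (g' := g2)) => v a /=.
by rewrite tens_mulll !id_tensE scalerAr.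
Qed.

Lemma id_tens_mulr chi x a :
  id_tens chi (x * tens H 1 a) = chi a *: id_tens chi x.
Proof.
pose mulH : {linear H -> H} := tens H 1 a \o* idfun.
pose g1 : {linear H -> U} := id_tens chi \o mulH.
pose g2 : {linear H -> U} := chi a \*: id_tens chi.
apply: (tens_ext (g := g1) (g' := g2)) => v b /=.
by rewrite tens_mulrr !id_tensE rmorphM scalerA mulrC.
Qed.

Lemma lact_id_tens chi h u' : lact chi h u' = id_tens chi (h * tens H u' 1).
Proof.
pose mulH : {linear H -> H} := tens H u' 1 \o* idfun.
pose g : {linear H -> U} := id_tens chi \o mulH.
apply: (tens_ext (g := tens_lift (lact_fun chi u')) (g' := g)) => u a /=.
rewrite tens_liftE /= /lact_fun -id_tens_mull mulrA.
by rewrite (tens_mulrr u 1 a) mul1r.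
Qed.

End Linearization.

(* The left H-module U_chi; its additive group is that of U. *)
Definition Uchi (k : fieldType) (U A : algType k) (H : tensor_algebra U A)
  (chi : Alg A) : Type := U.

Section InducedModule.
Variables (k : fieldType) (U A : algType k) (H : tensor_algebra U A).
Variable chi : Alg A.

HB.instance Definition _ := GRing.Zmodule.copy (Uchi H chi) U.

Definition Uchi_scale (h : H) (u : Uchi H chi) : Uchi H chi := lact chi h u.

Fact Uchi_scaleA h h' u :
  Uchi_scale h (Uchi_scale h' u) = Uchi_scale (h * h') u.
Proof.
rewrite /Uchi_scale !lact_id_tens -mulrA; move: (h' * _) => x {h' u}.
have lin : linear (fun x => h * tens H (id_tens H chi x) 1).
  by move=> a v w; rewrite linearP linearPl mulrDr scalerAr.
pose tensl : {linear H -> H} := HB.pack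
  (fun x => h * tens H (id_tens H chi x) 1) (GRing.isLinear.Build _ _ _ _ _ lin).
pose g1 : {linear H -> U} := id_tens H chi \o tensl.
pose g2 : {linear H -> U} := id_tens H chi \o (h \*o idfun).
apply: (tens_ext (g := g1) (g' := g2)) => v a /=.
rewrite -[in RHS](mul1r a) -(tens_mulrr H v 1 a) mulrA id_tens_mulr id_tensE.
by rewrite linearZl_LR /= -scalerAr linearZ.
Qed.

Fact Uchi_scale1 : left_id 1 Uchi_scale.
Proof.
by move=> u; rewrite /Uchi_scale lact_id_tens mul1r id_tensE rmorph1 scale1r.
Qed.

Fact Uchi_scaleDr : right_distributive Uchi_scale +%R.
Proof.
by move=> h u v; rewrite /Uchi_scale !lact_id_tens linearDl mulrDr linearD.
Qed.

Fact Uchi_scaleDl u : {morph Uchi_scale^~ u : h h' / h + h'}.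
Proof.
by move=> h h'; rewrite /Uchi_scale !lact_id_tens mulrDl linearD.
Qed.

HB.instance Definition _ := GRing.Zmodule_isLmodule.Build H (Uchi H chi)
  Uchi_scaleA Uchi_scale1 Uchi_scaleDr Uchi_scaleDl.

Lemma Uchi_scaleE (h : H) (u : Uchi H chi) : h *: u = lact chi h u.
Proof. by []. Qed.

End InducedModule.

(* The sum of a family [F] of submodules of [M]. *)
Definition submod_sum (R : pzRingType) (M : lmodType R)
    (F : {pred M} -> Prop) : {pred M} :=
  fun x => `[< exists s : seq M,
    (forall y, y \in s -> exists N : {pred M}, F N /\ y \in N) /\
    x = \sum_(y <- s) y >].

Lemma submod_sumP (R : pzRingType) (M : lmodType R) (F : {pred M} -> Prop) x :
  reflect (exists s : seq M,
    (forall y, y \in s -> exists N : {pred M}, F N /\ y \in N) /\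
    x = \sum_(y <- s) y) (x \in submod_sum F).
Proof. exact: asboolP. Qed.

Section MaximalSubmodule.
Variables (k : fieldType) (U A : algType k) (H : tensor_algebra U A).
Variables (rho : Alg U) (chi : Alg A).

Definition sub_of_Ker (N : {pred Uchi H chi}) : Prop :=
  submod_closed N /\ forall u, u \in N -> rho u = 0.

(* I(rho, chi) *)
Definition Isub : {pred Uchi H chi} := submod_sum sub_of_Ker.

Fact Isub_submod_closed : submod_closed Isub.
Proof.
split; first by apply/submod_sumP; exists [::]; split; rewrite ?big_nil.
move=> h x y /submod_sumP[s [sN ->]] /submod_sumP[t [tN ->]].
apply/submod_sumP; exists ([seq h *: z | z <- s] ++ t); split; last first.
  by rewrite big_cat /= big_map scaler_sumr.
move=> z; rewrite mem_cat => /orP[/mapP[w /sN[N [FN wN]] ->]|/tN//].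
exists N; split=> //; case: FN => [[N0 Nlin] _].
by have := Nlin h w 0 wN N0; rewrite addr0.
Qed.

HB.instance Definition _ := GRing.isSubmodClosed.Build H (Uchi H chi) Isub
  (GRing.submod_closed_semi Isub_submod_closed).

Lemma Isub_Ker u : u \in Isub -> rho u = 0.
Proof.
move=> /submod_sumP[s [sN ->]].
have -> : rho (\sum_(y <- s) y : Uchi H chi) = \sum_(y <- s) rho y.
  exact: (raddf_sum rho).
by apply: big1_seq => y /andP[_ /sN[N [[_ NK] /NK]]].
Qed.

Lemma sub_Isub (N : {pred Uchi H chi}) : sub_of_Ker N -> {subset N <= Isub}.
Proof.
move=> NK x xN; apply/submod_sumP; exists [:: x]; split; last first.
  by rewrite big_seq1.
by move=> y; rewrite inE => /eqP ->; exists N.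
Qed.

(* The underlying module of L(rho, chi); see [L] for the object of _H M. *)
Definition Lmod : Type := Quotient.quot Isub.

HB.instance Definition _ := GRing.Zmodule.on Lmod.

Definition Lmod_pi (u : Uchi H chi) : Lmod := \pi_(Quotient.quot Isub) u.
Definition Lmod_repr (x : Lmod) : Uchi H chi :=
  repr (x : Quotient.quot Isub).

Lemma Lmod_reprK : cancel Lmod_repr Lmod_pi.
Proof. exact: reprK. Qed.

Lemma Lmod_piE u v : (Lmod_pi u == Lmod_pi v) = (u - v \in Isub).
Proof. by rewrite Quotient.idealrBE. Qed.

Lemma Lmod_piD u v : Lmod_pi (u + v) = Lmod_pi u + Lmod_pi v.
Proof. exact: (raddfD (\pi_(Quotient.quot Isub))). Qed.

Definition Lmod_scale (h : H) (x : Lmod) : Lmod := Lmod_pi (h *: Lmod_repr x).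

Lemma Lmod_scale_pi h u : Lmod_scale h (Lmod_pi u) = Lmod_pi (h *: u).
Proof.
apply/eqP; rewrite Lmod_piE -scalerBr rpredZ //.
by rewrite -Lmod_piE Lmod_reprK.
Qed.

Fact Lmod_scaleA h h' x : Lmod_scale h (Lmod_scale h' x) = Lmod_scale (h * h') x.
Proof. by rewrite -(Lmod_reprK x) !Lmod_scale_pi scalerA. Qed.

Fact Lmod_scale1 : left_id 1 Lmod_scale.
Proof. by move=> x; rewrite -(Lmod_reprK x) !Lmod_scale_pi scale1r. Qed.

Fact Lmod_scaleDr : right_distributive Lmod_scale +%R.
Proof.
move=> h x y; rewrite -(Lmod_reprK x) -(Lmod_reprK y).
by rewrite -Lmod_piD !Lmod_scale_pi scalerDr Lmod_piD.
Qed.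

Fact Lmod_scaleDl x : {morph Lmod_scale^~ x : h h' / h + h'}.
Proof.
by move=> h h'; rewrite -(Lmod_reprK x) !Lmod_scale_pi scalerDl Lmod_piD.
Qed.

HB.instance Definition _ := GRing.Zmodule_isLmodule.Build H Lmod
  Lmod_scaleA Lmod_scale1 Lmod_scaleDr Lmod_scaleDl.

Lemma Lmod_piZ (h : H) u : Lmod_pi (h *: u) = h *: Lmod_pi u.
Proof. by rewrite -Lmod_scale_pi. Qed.

End MaximalSubmodule.

Arguments Isub {k U A} H rho chi.

(* The objects of the category _H M, up to isomorphism.  A left H-module is a
   k-vector space through [(c%:A : H) *: m]. *)
Section Category.
Variables (k : fieldType) (U A : algType k) (H : tensor_algebra U A).

(* k m is a one-dimensional left A-submodule of M. *)
Definition A_line (M : lmodType H) (m : M) : Prop :=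
  m <> 0 /\ forall a : A, exists c : k, tens H 1 a *: m = (c%:A : H) *: m.

Definition U_submodule (M : lmodType H) (N : {pred M}) : Prop :=
  0 \in N /\ forall (u : U) x y, x \in N -> y \in N ->
    tens H u 1 *: x + y \in N.

(* M / N is one-dimensional over k, spanned by the class of x. *)
Definition codim1 (M : lmodType H) (N : {pred M}) : Prop :=
  exists2 x : M, x \notin N & forall y : M, exists c : k,
    y - (c%:A : H) *: x \in N.

Definition in_HM (M : lmodType H) : Prop :=
  (exists m : M, A_line m /\ forall x : M, exists h : H, x = h *: m) /\
  (exists N : {pred M}, [/\ U_submodule N, codim1 N &
    forall P : {pred M}, submod_closed P -> {subset P <= N} ->
      forall x, x \in P -> x = 0]).

Record HM := HMObject { HM_mod :> lmodType H; HM_modP : in_HM HM_mod }.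

Definition HM_iso (M N : HM) : Prop :=
  exists (f : {linear M -> N}) (g : {linear N -> M}), cancel f g /\ cancel g f.

Lemma HM_iso_refl M : HM_iso M M.
Proof. by exists idfun, idfun. Qed.

Lemma HM_iso_sym M N : HM_iso M N -> HM_iso N M.
Proof. by move=> [f [g [fg gf]]]; exists g, f. Qed.

Lemma HM_iso_trans M N P : HM_iso M N -> HM_iso N P -> HM_iso M P.
Proof.
move=> [f [g [fg gf]]] [f' [g' [fg' gf']]].
exists (f' \o f), (g \o g'); split; exact: can_comp.
Qed.

(* Isomorphism classes, as predicates on objects; two of them are equal exactly
   when the objects are isomorphic: see [class_of_eq]. *)
Record HM_class := HMClass {
  HM_class_pred : HM -> Prop;
  HM_class_predP : exists M : HM, HM_class_pred = HM_iso M
}.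

Definition class_of (M : HM) : HM_class :=
  HMClass (ex_intro (fun N => HM_iso M = HM_iso N) M erefl).

Lemma class_of_eq M N : class_of M = class_of N <-> HM_iso M N.
Proof.
split=> [[eqMN] | isoMN].
  by rewrite eqMN; apply: HM_iso_refl.
have eqMN : HM_iso M = HM_iso N.
  apply/funext => P; apply/propext; split; apply: HM_iso_trans => //.
  exact: HM_iso_sym.
rewrite /class_of; move: (ex_intro _ M _) (ex_intro _ N _).
rewrite eqMN => p q; congr HMClass; exact: Prop_irrelevance.
Qed.

Lemma class_of_surj (c : HM_class) : exists M, c = class_of M.
Proof.
case: c => F FP; have [M FM] := FP; exists M; subst F.
congr HMClass; exact: Prop_irrelevance.
Qed.

Variables (rho : Alg U) (chi : Alg A).

Lemma Lmod_in_HM : in_HM (Lmod H rho chi).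
Proof.
pose u1 : Uchi H chi := (1 : U).
have scaleU (u v : U) : tens H u 1 *: (v : Uchi H chi) = u * v.
  by rewrite Uchi_scaleE lact_id_tens tens_mulll id_tensE rmorph1 scale1r.
have scale1 u : tens H u 1 *: u1 = u by rewrite scaleU mulr1.
have rho_scale u (v : Uchi H chi) : rho (tens H u 1 *: v) = rho u * rho v.
  by rewrite scaleU rmorphM.
have rhoB (u v : Uchi H chi) : rho (u - v) = rho u - rho v.
  exact: (raddfB rho).
have rhoD (u v : Uchi H chi) : rho (u + v) = rho u + rho v.
  exact: (raddfD rho).
have scalek (c : k) (u : Uchi H chi) : (c%:A : H) *: u = (c *: (u : U)).
  rewrite Uchi_scaleE lact_id_tens -scalerAl mul1r linearZ /=.
  by rewrite id_tensE rmorph1 scale1r.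
pose N : {pred Lmod H rho chi} := fun x => rho (Lmod_repr x) == 0.
have Npi u : (Lmod_pi rho u \in N) = (rho u == 0).
  rewrite unfold_in /N; have : Lmod_repr (Lmod_pi rho u) - u \in Isub H rho chi.
    by rewrite -Lmod_piE Lmod_reprK.
  by move=> /Isub_Ker; rewrite rhoB => /subr0_eq ->.
have N0 : 0 \in N.
  by rewrite -(scale0r (Lmod_pi rho u1)) -Lmod_piZ scale0r Npi (raddf0 rho).
split.
  exists (Lmod_pi rho u1); split; last first.
    move=> x; exists (tens H (Lmod_repr x) 1).
    by rewrite -Lmod_piZ scale1 Lmod_reprK.
  split.
    move=> pi0; have : Lmod_pi rho u1 \in N by rewrite pi0 N0.
    by rewrite Npi (rmorph1 rho) oner_eq0.
  move=> a; exists (chi a); rewrite -!Lmod_piZ scalek Uchi_scaleE lactE.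
  by rewrite mul1r tens11 mulr1 id_tensE.
exists N; split.
- split=> // u x y; rewrite -(Lmod_reprK x) -(Lmod_reprK y) -Lmod_piZ -Lmod_piD.
  by rewrite !Npi rhoD rho_scale => /eqP -> /eqP ->; rewrite mulr0 addr0.
- exists (Lmod_pi rho u1); first by rewrite Npi (rmorph1 rho) oner_eq0.
  move=> y; exists (rho (Lmod_repr y)).
  rewrite -{1}(Lmod_reprK y) -Lmod_piZ -scaleN1r -Lmod_piZ -Lmod_piD Npi.
  rewrite scaleN1r rhoB scalek.
  by rewrite (linearZ_LR rho) /= (rmorph1 rho) mulr1 subrr.
- move=> P Pclosed PN x xP; rewrite -(Lmod_reprK x).
  suff xI : Lmod_repr x \in Isub H rho chi.
    apply/eqP; rewrite -(scale0r x) -{2}(Lmod_reprK x) -Lmod_piZ Lmod_piE scale0r.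
    by rewrite subr0.
  apply: (@sub_Isub _ _ _ _ _ _ [pred u | Lmod_pi rho u \in P]); last first.
    by rewrite inE Lmod_reprK.
  split; last by move=> u; rewrite inE => /PN; rewrite Npi => /eqP.
  case: Pclosed => P0 Plin; split.
    by rewrite inE -(scale0r (0 : Uchi H chi)) Lmod_piZ scale0r.
  by move=> h u v; rewrite !inE Lmod_piD Lmod_piZ; apply: Plin.
Qed.

Definition L : HM := HMObject Lmod_in_HM.

End Category.

Arguments L {k U A} H rho chi.
Arguments restr {k X} Y f.

(* Main.v *)
(* Write m for the class of 1 in L = L(rho, chi); it is an A-eigenvector of
   character chi, and rho factors through a functional rho on L whose kernel
   contains no nonzero H-submodule.  Since H x = U x for an A-eigenvector x, and
   rho (u x) = rho(u) rho(x), an A-eigenvector killed by rho is zero; hence the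
   chi-eigenspace of A in L is k m.
   Injectivity: let L(rho, chi) be isomorphic to L(rho', chi') and let x be the
   image of m.  By (b), rho' (a' x) = chi'(a') rho'(x) for a' in A', while
   a' x = chi(a') x and rho'(x) <> 0, so chi = chi' on A'.  By (a), u' m is a
   chi-eigenvector for u' in U', so u' m = rho(u') m; applying the isomorphism
   and rho' gives rho = rho' on U'.
   Surjectivity: given M generated by an A-eigenvector m of character chi, the
   codimension one subspace N does not contain m (as M = U m), so U acts on
   M / N through some rho, and u |-> u m is an H-linear map from U_chi onto M
   with kernel I(rho, chi). *)
Require Import Defs.
From HB Require Import structures.
From mathcomp Require Import all_boot all_order all_algebra.
From mathcomp Require Import boolp.

Set Implicit Arguments.
Unset Strict Implicit.
Unset Printing Implicit Defensive.

Import GRing.Theory.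

Local Open Scope ring_scope.

(** * Generalities on characters and subspaces *)

Lemma Alg_ext (k : fieldType) (X : algType k) (f g : Alg X) : f =1 g -> f = g.
Proof.
case: f g => [f [[f1] [f2] [f3]]] [g [[g1] [g2] [g3]]] /= /funext fg.
move: f1 f2 f3; rewrite fg => f1 f2 f3.
by rewrite (Prop_irrelevance f1 g1) (Prop_irrelevance f2 g2)
  (Prop_irrelevance f3 g3).
Qed.

Lemma inj_surj_bij (T S : Type) (f : T -> S) :
  injective f -> (forall y, exists x, f x = y) -> bijective f.
Proof.
move=> f_inj f_surj; pose g y := sval (cid (f_surj y)).
have gK : cancel g f by move=> y; rewrite /g; case: cid.
by exists g => // x; apply: f_inj; rewrite gK.
Qed.

Section Subspace.
Variables (k : fieldType) (V : lmodType k) (Y : submodClosed V).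

(** A subspace is made a module in its own right, so that the universal property of the tensor
    product can take it as target. *)
Record subspace := Subspace { subspace_val :> V; _ : subspace_val \in Y }.

HB.instance Definition _ := [isSub for subspace_val].
HB.instance Definition _ := [Choice of subspace by <:].
HB.instance Definition _ := [SubChoice_isSubLmodule of subspace by <:].

End Subspace.

(** [X] acts on the one-dimensional module X/J by scalars, and this action is [chi]. *)
Lemma left_ideal_character (k : fieldType) (X : algType k) (J : X -> Prop) :
  ~ J 1 -> (forall a x y, J x -> J y -> J (a * x + y)) ->
  (forall a, exists c : k, J (a - c%:A)) ->
  exists chi : Alg X, forall a, J (a - (chi a)%:A).
Proof.
move=> J1 Jlin Jc; pose chi a := sval (cid (Jc a)).
have chiP a : J (a - (chi a)%:A) by rewrite /chi; case: cid.
have J0 : J 0.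
  have := Jlin (-1) _ _ (chiP 1) (chiP 1).
  by rewrite mulN1r addNr.
have JD x y : J x -> J y -> J (x + y).
  by move=> Jx Jy; rewrite -[x]mul1r; apply: Jlin.
have JM a x : J x -> J (a * x).
  by move=> Jx; rewrite -[a * x]addr0; apply: Jlin.
have JZ c x : J x -> J (c *: x).
  by move=> /(JM c%:A); rewrite mulr_algl.
(* Two candidates differ by a scalar in [J]; a nonzero one could be inverted, giving [J 1].
   Linearity and multiplicativity of [chi] then follow from this uniqueness. *)
have chi_uniq a c : J (a - c%:A) -> chi a = c.
  move=> Jac; apply/eqP; rewrite -subr_eq0; apply/negP => /negP nz.
  apply: J1; have : J ((chi a - c)%:A).
    have -> : (chi a - c)%:A = (a - c%:A) + (-1) *: (a - (chi a)%:A).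
      by rewrite scaleN1r opprB scalerBl [RHS]addrC addrA subrK.
    by apply: JD => //; apply: JZ.
  by move=> /(JZ (chi a - c)^-1); rewrite scalerA mulVf // scale1r.
have lin : linear_for *%R chi.
  move=> c x y; apply: chi_uniq.
  have -> : c *: x + y - (c * chi x + chi y)%:A
      = c *: (x - (chi x)%:A) + (y - (chi y)%:A).
    by rewrite scalerDl scalerBr scalerA opprD addrACA.
  by apply: JD => //; apply: JZ.
have mon : monoid_morphism chi.
  split; first by apply: chi_uniq; rewrite scale1r subrr.
  move=> x y; apply: chi_uniq.
  have -> : x * y - (chi x * chi y)%:A
      = x * (y - (chi y)%:A) + chi y *: (x - (chi x)%:A).
    by rewrite mulrBr -scalerAr mulr1 scalerBr scalerA addrA subrK mulrC.
  by apply: JD; [apply: JM | apply: JZ].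
pose chi' : {lrmorphism X -> k | *%R} := HB.pack chi
  (GRing.isLinear.Build _ _ _ _ _ lin) (GRing.isMonoidMorphism.Build _ _ _ mon).
by exists chi'.
Qed.

(** * Pure tensors and A-eigenvectors *)

Section TensorAlgebra.
Variables (k : fieldType) (U A : algType k) (H : tensor_algebra U A).

(** Lift [tens] to a map from [H] into the subspace cut out by [P]; followed by the inclusion it is
    the identity, by uniqueness in the universal property. *)
Lemma tens_ind (P : H -> Prop) :
  (forall u a, P (tens H u a)) ->
  (forall c x y, P x -> P y -> P (c *: x + y)) -> forall h, P h.
Proof.
move=> Pt Plin; pose Q : {pred H} := fun h => `[< P h >].
have Qc : submod_closed Q.
  split; first by apply/asboolP; rewrite -(linear0l (tens H) 0).
  by move=> c x y /asboolP Px /asboolP Py; apply/asboolP/Plin.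
pose QS : submodClosed H := HB.pack Q
  (GRing.isSubmodClosed.Build k H Q (GRing.submod_closed_semi Qc)).
have Qt u a : tens H u a \in QS by apply/asboolP.
pose f u a : subspace QS := Subspace (Qt u a).
have bil : bilinear_for *:%R *:%R f.
  split=> [a c u u' | u c a a']; apply: val_inj => /=.
    by rewrite linearPl.
  by rewrite linearPr.
pose F : {bilinear U -> A -> subspace QS} :=
  HB.pack f (bilinear_isBilinear.Build _ _ _ _ _ _ _ bil).
pose v : {linear subspace QS -> H} := val.
have vK : v \o tens_lift H F =1 idfun.
  by apply: tens_ext => u a /=; rewrite tens_liftE.
by move=> h; have /= <- := vK h; apply/asboolP; case: (tens_lift H F h).
Qed.

Lemma alg_scaleC (M : lmodType H) (h : H) (c : k) (m : M) :
  h *: ((c%:A : H) *: m) = (c%:A : H) *: (h *: m).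
Proof. by rewrite !scalerA mulr_algl mulr_algr. Qed.

(** Both sides are rho (x) chi at [h]; this links the left action on U_chi to the right action on
    A_rho. *)
Lemma id_tens_tens_id (rho : Alg U) (chi : Alg A) (h : H) :
  rho (id_tens H chi h) = chi (tens_id H rho h).
Proof.
elim/tens_ind: h => [u a | c x y IHx IHy].
  by rewrite id_tensE tens_idE !linearZ /= mulrC.
by rewrite !linearP /= IHx IHy.
Qed.

Definition A_eigen (M : lmodType H) (chi : Alg A) (m : M) :=
  forall a, tens H 1 a *: m = ((chi a)%:A : H) *: m.

(** In u (x) a = (u (x) 1)(1 (x) a) the right factor acts on [m] by [chi a]; hence H m = U m. *)
Lemma A_eigen_scale (M : lmodType H) chi (m : M) : A_eigen chi m ->
  forall h, h *: m = tens H (id_tens H chi h) 1 *: m.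
Proof.
move=> mchi; elim/tens_ind => [u a | c x y IHx IHy].
  rewrite -[a in LHS]mul1r -tens_mulrr -scalerA mchi scalerA -scalerAr mulr1.
  by rewrite id_tensE linearZl_LR.
rewrite linearP linearPl !scalerDl IHy; congr (_ + _).
by rewrite -[c *: x]mulr_algl -[c *: tens _ _ _]mulr_algl -!scalerA IHx.
Qed.

(** * The functional induced by rho on L(rho, chi) *)

Section Quotient.
Variables (rho : Alg U) (chi : Alg A).

Definition Lcyc : Lmod H rho chi := Lmod_pi rho (1 : U).

Definition Lrho (x : Lmod H rho chi) : k := rho (Lmod_repr x).

Lemma Lrho_pi u : Lrho (Lmod_pi rho u) = rho u.
Proof.
have : Lmod_repr (Lmod_pi rho u) - u \in Isub H rho chi.
  by rewrite -Lmod_piE Lmod_reprK.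
by move=> /Isub_Ker; rewrite (raddfB rho) => /subr0_eq.
Qed.

Lemma Lrho_cyc : Lrho Lcyc = 1.
Proof. by rewrite Lrho_pi rmorph1. Qed.

Lemma LrhoD x y : Lrho (x + y) = Lrho x + Lrho y.
Proof.
by rewrite -(Lmod_reprK x) -(Lmod_reprK y) -Lmod_piD !Lrho_pi (raddfD rho).
Qed.

Lemma Lrho_U u x : Lrho (tens H u 1 *: x) = rho u * Lrho x.
Proof.
rewrite -(Lmod_reprK x) -Lmod_piZ !Lrho_pi Uchi_scaleE lact_id_tens tens_mulll.
by rewrite id_tensE rmorph1 scale1r rmorphM.
Qed.

Lemma Lrho_Z c x : Lrho ((c%:A : H) *: x) = c * Lrho x.
Proof. by rewrite -(tens11 H) -linearZl_LR Lrho_U linearZ /= rmorph1 mulr1. Qed.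

Lemma Lmod_piU u : Lmod_pi rho u = tens H u 1 *: Lcyc.
Proof.
rewrite -Lmod_piZ Uchi_scaleE lact_id_tens tens_mulll.
by rewrite id_tensE rmorph1 scale1r mulr1.
Qed.

Lemma Lcyc_A_eigen : A_eigen chi Lcyc.
Proof.
move=> a; rewrite -(tens11 H) -linearZl_LR -Lmod_piU -Lmod_piZ Uchi_scaleE.
by rewrite lactE mul1r tens11 mulr1 id_tensE.
Qed.

(** A representative of [x] generates a submodule of U_chi inside Ker rho, hence inside I(rho,
    chi). *)
Lemma Lrho_eq0 (x : Lmod H rho chi) : (forall h : H, Lrho (h *: x) = 0) -> x = 0.
Proof.
move=> x0; have pi0 : Lmod_pi rho (0 : Uchi H chi) = 0.
  by rewrite -(scale0r (0 : Uchi H chi)) Lmod_piZ scale0r.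
apply/eqP; rewrite -pi0 -(Lmod_reprK x) Lmod_piE subr0.
pose P : {pred Uchi H chi} := fun u => `[< exists h : H, u = h *: Lmod_repr x >].
apply: (@sub_Isub _ _ _ _ _ _ P); last first.
  by apply/asboolP; exists 1; rewrite scale1r.
split; last first.
  by move=> u /asboolP[h ->]; rewrite -Lrho_pi Lmod_piZ Lmod_reprK.
split; first by apply/asboolP; exists 0; rewrite scale0r.
move=> h u v /asboolP[h1 ->] /asboolP[h2 ->]; apply/asboolP.
by exists (h * h1 + h2); rewrite scalerDl scalerA.
Qed.

Lemma A_eigen_Lrho_eq0 chi' x : A_eigen chi' x -> Lrho x = 0 -> x = 0.
Proof.
move=> xchi x0; apply: Lrho_eq0 => h.
by rewrite (A_eigen_scale xchi) Lrho_U x0 mulr0.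
Qed.

Lemma A_eigen_Lcyc x : A_eigen chi x -> x = ((Lrho x)%:A : H) *: Lcyc.
Proof.
move=> xchi; apply/subr0_eq; apply: (@A_eigen_Lrho_eq0 chi).
  by move=> a; rewrite !scalerBr xchi alg_scaleC Lcyc_A_eigen -alg_scaleC.
by rewrite -scaleNr -scaleNr LrhoD Lrho_Z Lrho_cyc mulr1 subrr.
Qed.

(** With u representing [x], the left side is (rho (x) chi)((1 (x) a')(u (x) 1)), that is, [chi] of
    the right action of u on a' in A_rho. *)
Lemma A_eigen_Lrho (A' : subalgClosed A) :
  (forall a' u a, a' \in A' -> ract rho a' (tens H u a) = rho u *: (a' * a)) ->
  forall a' x, a' \in A' -> Lrho (tens H 1 a' *: x) = chi a' * Lrho x.
Proof.
move=> hA' a' x a'A; rewrite -(Lmod_reprK x) -Lmod_piZ !Lrho_pi.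
rewrite Uchi_scaleE lactE mul1r id_tens_tens_id.
have := hA' a' (Lmod_repr x) 1 a'A; rewrite ractE !mulr1 => ->.
by rewrite linearZ mulrC.
Qed.

Lemma U'_A_eigen (U' : subalgClosed U) :
  (forall u a u', u' \in U' -> lact chi (tens H u a) u' = chi a *: (u * u')) ->
  forall u', u' \in U' -> A_eigen chi (tens H u' 1 *: Lcyc).
Proof.
move=> hU' u' u'U a; rewrite -{1}Lmod_piU -Lmod_piZ Uchi_scaleE hU' //.
by rewrite mul1r Lmod_piU linearZl_LR /= scalerA mulr_algl.
Qed.

End Quotient.

(** * Injectivity: recovering the characters from L(rho, chi) *)

Section Classification.
Variables (rho rho' : Alg U) (chi chi' : Alg A).
Variable f : {linear Lmod H rho chi -> Lmod H rho' chi'}.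
Hypothesis f_inj : injective f.

Lemma A_eigen_iso : A_eigen chi (f (Lcyc rho chi)).
Proof. by move=> a; rewrite -linearZ_LR Lcyc_A_eigen linearZ_LR. Qed.

Lemma Lrho_iso_neq0 : Lrho (f (Lcyc rho chi)) != 0.
Proof.
apply/eqP => /(A_eigen_Lrho_eq0 A_eigen_iso) f0.
have /f_inj c0 : f (Lcyc rho chi) = f 0 by rewrite f0 linear0.
have := Lrho_cyc rho chi; rewrite c0 -(scale0r (Lcyc rho chi)).
by rewrite -[0 : H](scale0r 1) Lrho_Z mul0r => /esym/eqP; rewrite oner_eq0.
Qed.

Lemma chi_iso (A' : subalgClosed A) :
  (forall a' rho u a, a' \in A' ->
     ract rho a' (tens H u a) = rho u *: (a' * a)) ->
  injective (restr A') -> chi = chi'.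
Proof.
move=> hA' rA'; apply: rA'; apply: Alg_ext => -[a aA] /=.
apply: (mulIf Lrho_iso_neq0).
by rewrite -Lrho_Z -A_eigen_iso (A_eigen_Lrho (A' := A')) // => *; apply: hA'.
Qed.

Lemma rho_iso (U' : subalgClosed U) :
  (forall u a chi u', u' \in U' ->
     lact chi (tens H u a) u' = chi a *: (u * u')) ->
  injective (restr U') -> rho = rho'.
Proof.
move=> hU' rU'; apply: rU'; apply: Alg_ext => -[u uU] /=.
apply: (mulIf Lrho_iso_neq0).
rewrite -Lrho_U -Lrho_Z -!linearZ_LR; congr (Lrho (f _)).
(* In the source, u m is a [chi]-eigenvector, so it is the multiple of m given by its value under
   [Lrho]. *)
rewrite [RHS](A_eigen_Lcyc (U'_A_eigen rho (fun u a => hU' u a chi) uU)).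
by rewrite Lrho_U Lrho_cyc mulr1.
Qed.

End Classification.

(** * Surjectivity: extracting the characters from an object *)

Lemma in_HM_characters (M : lmodType H) : in_HM M ->
  exists (rho : Alg U) (chi : Alg A) (m : M) (N : {pred M}),
  [/\ A_eigen chi m, forall x, exists h : H, x = h *: m,
    forall u, tens H u 1 *: m \in N <-> rho u = 0 &
    forall P : {pred M}, submod_closed P -> {subset P <= N} ->
      forall x, x \in P -> x = 0].
Proof.
move=> [[m [[m0 mA] mgen]] [N [[N0 NU] [x0 x0N Nx0] Nfaith]]].
have ND x y : x \in N -> y \in N -> x + y \in N.
  by move=> xN yN; rewrite -[x]scale1r -(tens11 H); apply: NU.
have NM u x : x \in N -> tens H u 1 *: x \in N.
  by move=> xN; rewrite -[_ *: _]addr0; apply: NU.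
have kE (c : k) : (c%:A : H) = tens H c%:A 1 by rewrite linearZl_LR /= tens11.
have kEr (c : k) : (c%:A : H) = tens H 1 c%:A by rewrite linearZr_LR /= tens11.
have NZ (c : k) x : x \in N -> (c%:A : H) *: x \in N by rewrite kE; apply: NM.
have NN x : x \in N -> - x \in N by rewrite -scaleN1r -scaleN1r; apply: NZ.
(* The annihilator of [m] in [A] is a left ideal of codimension one. *)
have [chi chiP] : exists chi : Alg A, A_eigen chi m.
  have [|a x y|a|chi chiP] := @left_ideal_character k A (fun a => tens H 1 a *: m = 0).
  - by rewrite tens11 scale1r.
  - move=> x0' y0'; rewrite linearDr scalerDl y0' addr0.
    by rewrite -tens_mulrr -scalerA x0' scaler0.
  - have [c mc] := mA a; exists c; rewrite linearBr scalerBl mc -kEr.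
    by rewrite subrr.
  - exists chi => a; apply/subr0_eq; rewrite kEr -scalerBl -linearBr.
    exact: chiP.
have mU x : exists u, x = tens H u 1 *: m.
  have [h ->] := mgen x.
  by exists (id_tens H chi h); rewrite (A_eigen_scale chiP).
have mN : m \notin N.
  by apply/negP => mN; case/negP: x0N; have [u ->] := mU x0; apply: NM.
(* [m] replaces [x0] as spanning vector of M/N: modulo [N], m = c x0 with c nonzero and y = d x0, so
   y = (d/c) m. *)
have Nm y : exists c : k, y - (c%:A : H) *: m \in N.
  have [c mc] := Nx0 m; have [d yd] := Nx0 y.
  have c0 : c != 0.
    apply/eqP => c0; case/negP: mN; move: mc.
    by rewrite c0 scale0r scale0r subr0.
  exists (d / c).
  have -> : y - ((d / c)%:A : H) *: m
      = (y - (d%:A : H) *: x0) - ((d / c)%:A : H) *: (m - (c%:A : H) *: x0).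
    rewrite scalerBr scalerA -scalerAl mul1r scalerA divfK //.
    by rewrite opprB addrA subrK.
  by apply: ND => //; apply/NN/NZ.
(* The elements of [U] sending [m] into [N] form a left ideal of codimension one. *)
have [|a x y|u|rho rhoP] :=
  @left_ideal_character k U (fun u => tens H u 1 *: m \in N).
- by rewrite tens11 scale1r; apply/negP.
- by move=> xN yN; rewrite linearDl scalerDl -tens_mulll -scalerA; apply: NU.
- have [c uc] := Nm (tens H u 1 *: m); exists c.
  by rewrite linearBl scalerBl -kE.
exists rho, chi, m, N; split=> // u.
have {rhoP} := rhoP u; rewrite linearBl scalerBl -kE => uN; split; last first.
  by move=> u0; move: uN; rewrite u0 scale0r scale0r subr0.
move=> umN; apply/eqP; apply/negP => /negP u0; case/negP: mN.
have /(NZ (rho u)^-1) : ((rho u)%:A : H) *: m \in N.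
  by rewrite -[_ *: m](subKr (tens H u 1 *: m)); apply: ND => //; apply: NN.
by rewrite scalerA -scalerAl mul1r scalerA mulVf // !scale1r.
Qed.

Lemma HM_is_L (M : HM H) : exists rho chi, HM_iso (L H rho chi) M.
Proof.
have [rho [chi [m [N [mchi mgen mN Nfaith]]]]] := in_HM_characters (HM_modP M).
exists rho, chi.
pose F (u : Uchi H chi) : M := tens H u 1 *: m.
have FB u v : F (u - v) = F u - F v by rewrite /F linearBl scalerBl.
have FZ (h : H) u : F (h *: u) = h *: F u.
  by rewrite /F scalerA (A_eigen_scale mchi (h * _)) Uchi_scaleE lact_id_tens.
(* The image of I(rho, chi) is a submodule inside [N], hence zero; conversely Ker F is a submodule
   inside Ker rho. *)
have FI u : u \in Isub H rho chi <-> F u = 0.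
  split=> [uI | Fu0].
    pose P : {pred M} := fun x => `[< exists2 v, v \in Isub H rho chi & x = F v >].
    apply: (Nfaith P); last by apply/asboolP; exists u.
      have [I0 Ilin] := Isub_submod_closed H rho chi.
      split; first by apply/asboolP; exists 0 => //; rewrite /F linear0l scale0r.
      move=> h x y /asboolP[v vI ->] /asboolP[w wI ->]; apply/asboolP.
      exists (h *: v + w); first exact: Ilin.
      by rewrite -FZ /F linearDl scalerDl.
    by move=> x /asboolP[v /Isub_Ker v0 ->]; apply/mN.
  apply: (@sub_Isub _ _ _ _ _ _ [pred v | F v == 0]); last by rewrite inE Fu0.
  split; last first.
    move=> v; rewrite inE => /eqP Fv0; apply/mN; rewrite -/(F v) Fv0.
    (* That 0 lies in [N] is [mN] at u = 0. *)
    by have /mN := raddf0 rho; rewrite linear0l scale0r.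
  split=> [|h v w]; first by rewrite inE /F linear0l scale0r.
  rewrite !inE => /eqP v0 /eqP w0.
  by rewrite /F linearDl scalerDl -/(F _) FZ v0 scaler0 add0r -/(F w) w0.
pose f (x : L H rho chi) : M := F (Lmod_repr x).
have f_pi u : f (Lmod_pi rho u) = F u.
  apply/subr0_eq; rewrite -FB; apply/FI.
  by rewrite -Lmod_piE Lmod_reprK.
have f_lin : linear f.
  move=> h x y; rewrite -(Lmod_reprK x) -(Lmod_reprK y) -Lmod_piZ -Lmod_piD.
  by rewrite !f_pi -FZ /F linearDl scalerDl.
have f_inj : injective f.
  move=> x y; rewrite -(Lmod_reprK x) -(Lmod_reprK y) !f_pi => Fxy.
  by apply/eqP; rewrite Lmod_piE; apply/FI; rewrite FB Fxy subrr.
have f_surj x : exists y, f y = x.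
  have [h ->] := mgen x; exists (Lmod_pi rho (id_tens H chi h)).
  by rewrite f_pi /F -(A_eigen_scale mchi).
have [g fK gK] := inj_surj_bij f_inj f_surj.
have g_lin : linear g.
  by move=> h x y; apply: f_inj; rewrite f_lin !gK.
pose F1 : {linear L H rho chi -> M} :=
  HB.pack f (GRing.isLinear.Build _ _ _ _ _ f_lin).
pose G1 : {linear M -> L H rho chi} :=
  HB.pack g (GRing.isLinear.Build _ _ _ _ _ g_lin).
by exists F1, G1.
Qed.

End TensorAlgebra.

Theorem theorem3p3 (k : fieldType) (U A : algType k) (H : tensor_algebra U A)
    (U' : subalgClosed U) (A' : subalgClosed A)
    (hU' : forall (u : U) (a : A) (chi : Alg A) (u' : U), u' \in U' ->
       lact chi (tens H u a) u' = chi a *: (u * u'))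
    (rU' : injective (restr U'))
    (hA' : forall (a' : A) (rho : Alg U) (u : U) (a : A), a' \in A' ->
       ract rho a' (tens H u a) = rho u *: (a' * a))
    (rA' : injective (restr A')) :
  bijective (fun p : Alg U * Alg A => class_of (L H p.1 p.2)).
Proof.
apply: inj_surj_bij => [[rho chi] [rho' chi'] /= | c].
  move=> /class_of_eq[f [g [/can_inj f_inj _]]].
  by rewrite (rho_iso f_inj hU' rU') (chi_iso f_inj hA' rA').
have [M ->] := class_of_surj c; have [rho [chi isoM]] := HM_is_L M.
by exists (rho, chi); apply/class_of_eq.
Qed.
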